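(* Let $\pi$ be a Borel probability measure on $\mathcal{X}$ and $(\mathcal{P}_\gamma)_{\gamma\in\mathcal{Y}}$ a family of Borel Markov kernels on $\mathcal{X}$ as in the context. Assume there is a Borel function $W:\mathcal{X}\to[1,\infty)$ and constants $C\in(0,1]$ and $\kappa\in(0,\infty)$ such that $$\pi(\{x: W(x)\ge r\})\ge C r^{-\kappa}\quad\text{for all } r\ge 1,$$ and there are $\alpha>\kappa$ and a concave function $\phi:(0,\infty)\to(0,\infty)$ such that $$\int_{\mathcal{X}}W(y)^\alpha\,\mathcal{P}_\gamma(x,dy)-W(x)^\alpha\le\phi(W(x)^\alpha)\quad\text{for all }(x,\gamma)\in\mathcal{X}\times\mathcal{Y}.$$ Then for all $t\in\mathbb{Z}_+$ (and any initialization $(\gamma_0,x_0)\in\mathcal{Y}\times\mathcal{X}$), $$\inf_{\mathcal{Q}\in\mathcal{S}(\mathcal{X},\mathcal{Y})}\left\|\mathcal{A}_{\mathcal{Q}}^{(t)}((\gamma_0,x_0),\cdot)-\pi\right\|_{\mathrm{TV}}\ge\frac{M}{\left(H^{-1}_{W(x_0)^\alpha,\phi}(t)\right)^{\frac{\kappa}{\alpha-\kappa}}},$$ where $$M=C^{\frac{\alpha}{\alpha-\kappa}}\left[(\kappa/\alpha)^{\frac{\kappa}{\alpha-\kappa}}-(\kappa/\alpha)^{\frac{\alpha}{\alpha-\kappa}}\right].$$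
   Context: $\mathcal{X}$ is a Polish space (state space) and $\mathcal{Y}$ is a Borel measurable space (tuning parameters), with Borel sigma-algebras $\mathcal{B}(\mathcal{X}),\mathcal{B}(\mathcal{Y})$. $\mathbb{Z}_+$ denotes the positive integers. $(\mathcal{P}_\gamma)_{\gamma\in\mathcal{Y}}$ is a family of Markov kernels $\mathcal{P}_\gamma:\mathcal{X}\times\mathcal{B}(\mathcal{X})\to[0,1]$ such that $(x,\gamma)\mapsto\mathcal{P}_\gamma(x,\cdot)$ is Borel measurable. Adaptive process: an adaptation plan $\mathcal{Q}$ is a sequence $(\mathcal{Q}_t)_{t\in\mathbb{Z}_+}$ of Borel probability kernels $\mathcal{Q}_t:(\mathcal{Y}\times\mathcal{X})^t\times\mathcal{B}(\mathcal{Y})\to[0,1]$; $\mathcal{S}(\mathcal{X},\mathcal{Y})$ is the set of all adaptation plans. Given $\mathcal{Q}$ and a fixed initialization $(\Gamma_0,X_0)=(\gamma_0,x_0)\in\mathcal{Y}\times\mathcal{X}$, the adaptive process $(\Gamma_t,X_t)_{t\ge0}$ is defined for $t\ge1$ by $\Gamma_t\mid(\Gamma_s,X_s)_{0\le s\le t-1}\sim\mathcal{Q}_t((\Gamma_s,X_s)_{0\le s\le t-1},\cdot)$ and then, conditionally on $\Gamma_t$ and the past, $X_t\sim\mathcal{P}_{\Gamma_t}(X_{t-1},\cdot)$. The marginal law of $X_t$ is denoted $\mathcal{A}_{\mathcal{Q}}^{(t)}((\gamma_0,x_0),\cdot)$. Total variation: $\|\mu-\nu\|_{\mathrm{TV}}=\inf_{\xi\in\mathcal{C}(\mu,\nu)}\xi(\{(x,y):x\ne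 y\})$, where $\mathcal{C}(\mu,\nu)$ is the set of couplings of $\mu$ and $\nu$ (Borel probability measures on $\mathcal{X}\times\mathcal{X}$ with marginals $\mu,\nu$). For concave $\phi:(0,\infty)\to(0,\infty)$ and $w_0\in[1,\infty)$, define $H_{w_0,\phi}(w)=\int_{w_0}^w\frac{dv}{\phi(v)}$ for $w\ge w_0$; this is a strictly increasing function from $[w_0,\infty)$ onto $[0,\infty)$ and $H^{-1}_{w_0,\phi}:[0,\infty)\to[w_0,\infty)$ denotes its inverse. *)

(* Defs.v *)
From HB Require Import structures.
From mathcomp Require Import all_boot all_order all_algebra.
From mathcomp Require Import all_classical all_reals all_analysis.
From mathcomp Require Import measurable_realfun.

Set Implicit Arguments.
Unset Strict Implicit.
Unset Printing Implicit Defensive.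

Import Order.TTheory GRing.Theory Num.Theory.
Import numFieldNormedType.Exports.

Local Open Scope classical_set_scope.
Local Open Scope ring_scope.

Notation borel T := (g_sigma_algebraType (@open T)).

Section polish.
Context (R : realType) (T : ptopologicalType).
Implicit Type d : T -> T -> R.

Definition is_metric d :=
  [/\ forall x y, 0 <= d x y,
      forall x y, d x y = 0 <-> x = y,
      forall x y, d x y = d y x &
      forall x y z, d x z <= d x y + d y z].

Definition induces_topology d :=
  forall (x : T) (A : set T),
    nbhs x A <-> exists2 e : R, 0 < e & [set y | d x y < e] `<=` A.

Definition metric_complete d :=
  forall u : nat -> T,
    (forall e : R, 0 < e -> exists N : nat, forall m n : nat,
       (N <= m)%N -> (N <= n)%N -> d (u m) (u n) < e) ->
    exists l : T, u @ \oo --> l.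

Definition polish_space :=
  (exists D : set T, countable D /\ dense D) /\
  (exists d, [/\ is_metric d, induces_topology d & metric_complete d]).

End polish.

Section adaptive_process.
Context {dX dY} {X : measurableType dX} {Y : measurableType dY} {R : realType}.

(* [n.+1.-tuple (Y * X)] is the space of histories (Gamma_s, X_s), 0 <= s <= n,
   in chronological order; tuples carry the product sigma-algebra. *)
Definition last_state n (h : n.+1.-tuple (Y * X)) : X := (tnth h ord_max).2.

(* [Q n] is the kernel that draws Gamma_{n+1} given (Gamma_s, X_s), s <= n; it
   is the (n+1)-st term of a plan indexed by the positive integers. *)
Definition adaptation_plan := forall n : nat, R.-pker (n.+1.-tuple (Y * X)) ~> Y.

Lemma measurable_last_state n : measurable_fun setT (@last_state n).
Proof.
apply: (@measurableT_comp _ _ _ _ _ _ snd) => //.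
exact: measurable_tnth.
Qed.

HB.instance Definition _ n :=
  isMeasurableFun.Build _ _ _ _ (@last_state n) (@measurable_last_state n).

Definition append n (hg : n.+1.-tuple (Y * X) * Y) (x : X) :
  n.+2.-tuple (Y * X) := [tuple of rcons hg.1 (hg.2, x)].

Lemma measurable_append_uncurry n :
  measurable_fun setT (fun z : (n.+1.-tuple (Y * X) * Y) * X => append z.1 z.2).
Proof.
apply/measurable_fun_tnthP => i.
have [i_lt|i_ge] := ltnP i n.+1.
  rewrite (_ : _ \o _ = (fun h => tnth h (Ordinal i_lt)) \o (fst \o fst)).
    apply: measurableT_comp; first exact: measurable_tnth.
    exact: measurableT_comp.
  apply/funext => -[[h g] x] /=; rewrite !(tnth_nth (g, x)) /= nth_rcons.
  by rewrite size_tuple i_lt.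
rewrite (_ : _ \o _ = fun z => (z.1.2, z.2)).
  apply: measurable_fun_pair => //; exact: measurableT_comp.
apply/funext => -[[h g] x] /=; rewrite (tnth_nth (g, x)) /= nth_rcons.
rewrite size_tuple ltnNge i_ge /= ifT//.
by rewrite eqn_leq i_ge -ltnS ltn_ord.
Qed.

Lemma measurable_append n hg : measurable_fun setT (@append n hg).
Proof.
rewrite (_ : append hg = (fun z => append z.1 z.2) \o pair hg)//.
by apply: measurableT_comp => //; exact: measurable_append_uncurry.
Qed.

HB.instance Definition _ n hg :=
  isMeasurableFun.Build _ _ _ _ (@append n hg) (@measurable_append n hg).

Section next_state_kernel.
Variables (P : R.-pker (X * Y) ~> X) (n : nat).

Definition next_state (hg : n.+1.-tuple (Y * X) * Y) :
    {measure set X -> \bar R} :=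
  P (last_state hg.1, hg.2).

Lemma measurable_next_state U : measurable U ->
  measurable_fun setT (next_state ^~ U).
Proof.
move=> mU; apply: (@measurableT_comp _ _ _ _ _ _ (P ^~ U)).
  exact: measurable_kernel.
apply: measurable_fun_pair => //.
by apply: measurableT_comp => //; exact: measurable_last_state.
Qed.

HB.instance Definition _ :=
  isKernel.Build _ _ _ _ _ next_state measurable_next_state.

Lemma next_state_setT hg : next_state hg setT = 1%E.
Proof. exact: prob_kernel. Qed.

HB.instance Definition _ :=
  Kernel_isProbability.Build _ _ _ _ _ next_state next_state_setT.

End next_state_kernel.

(* The history extended by (Gamma_{n+1}, X_{n+1}), given (Gamma_s, X_s), s <= n,
   and Gamma_{n+1}. *)
Definition append_pushforward (P : R.-pker (X * Y) ~> X) n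
    (hg : n.+1.-tuple (Y * X) * Y) : set (n.+2.-tuple (Y * X)) -> \bar R :=
  pushforward (next_state P hg) (append hg).

Section append_pushforward_measure.
Variables (P : R.-pker (X * Y) ~> X) (n : nat).
Variable hg : n.+1.-tuple (Y * X) * Y.

Lemma append_pushforward0 : append_pushforward P hg set0 = 0%E.
Proof. by rewrite /append_pushforward /pushforward preimage_set0 measure0. Qed.

Lemma append_pushforward_ge0 A : (0 <= append_pushforward P hg A)%E.
Proof. exact: measure_ge0. Qed.

Lemma append_pushforward_sigma_additive :
  semi_sigma_additive (append_pushforward P hg).
Proof.
move=> F mF tF mUF; rewrite /append_pushforward /pushforward preimage_bigcup.
apply: measure_semi_sigma_additive.
- by move=> i; rewrite -[X in measurable X]setTI; exact: measurable_append.
- apply/trivIsetP => /= i j _ _ ij; rewrite -preimage_setI.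
  by move/trivIsetP : tF => /(_ i j I I ij) ->; rewrite preimage_set0.
- rewrite -preimage_bigcup -[X in measurable X]setTI.
  exact: measurable_append.
Qed.

HB.instance Definition _ := isMeasure.Build _ _ _ (append_pushforward P hg)
  append_pushforward0 append_pushforward_ge0 append_pushforward_sigma_additive.

End append_pushforward_measure.

Definition append_state (P : R.-pker (X * Y) ~> X) n :
    n.+1.-tuple (Y * X) * Y ->
    {measure set (n.+2.-tuple (Y * X)) -> \bar R} :=
  append_pushforward P (n := n).

Section append_state_kernel.
Variables (P : R.-pker (X * Y) ~> X) (n : nat).

Lemma measurable_append_state U : measurable U ->
  measurable_fun setT (@append_state P n ^~ U).
Proof.
move=> mU.
pose V := (fun z => append z.1 z.2) @^-1` U :
  set ((n.+1.-tuple (Y * X) * Y) * X).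
have mV : measurable V.
  by rewrite -[V]setTI; exact: measurable_append_uncurry.
apply: (eq_measurable_fun (fun hg => next_state P hg (xsection V hg))).
  by move=> hg _; rewrite xsectionE.
exact/measurable_fun_xsection_finite_kernel/mem_set.
Qed.

HB.instance Definition _ := isKernel.Build _ _ _ _ _
  (@append_state P n) measurable_append_state.

Lemma append_state_setT hg : append_state P (n := n) hg setT = 1%E.
Proof. exact: prob_kernel. Qed.

HB.instance Definition _ := Kernel_isProbability.Build _ _ _ _ _
  (@append_state P n) append_state_setT.

End append_state_kernel.

(* \int[Q n h]_g P (X_n, g) {x | (h, (g, x)) \in A} *)
Definition one_step (P : R.-pker (X * Y) ~> X) (Q : adaptation_plan) n :
    n.+1.-tuple (Y * X) -> {measure set (n.+2.-tuple (Y * X)) -> \bar R} :=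
  mkcomp (Q n) (append_state P (n := n)).

Section one_step_kernel.
Variables (P : R.-pker (X * Y) ~> X) (Q : adaptation_plan) (n : nat).

Lemma measurable_one_step U : measurable U ->
  measurable_fun [set: n.+1.-tuple (Y * X)] (@one_step P Q n ^~ U).
Proof. by move=> mU; exact: measurable_fun_mkcomp_sfinite. Qed.

HB.instance Definition _ := isKernel.Build _ _ _ _ _
  (@one_step P Q n) measurable_one_step.

Lemma one_step_setT h : one_step P Q (n := n) h setT = 1%E.
Proof.
rewrite (_ : one_step P Q h setT = \int[Q n h]__ 1)%E.
  by rewrite integral_cst// mul1e prob_kernel.
by apply: eq_integral => g _; exact: append_state_setT.
Qed.

HB.instance Definition _ := Kernel_isProbability.Build _ _ _ _ _
  (@one_step P Q n) one_step_setT.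

End one_step_kernel.

Section kbind.
Context {d1 d2} {T1 : measurableType d1} {T2 : measurableType d2}.

Definition kbind (mu : probability T1 R) (k : R.-pker T1 ~> T2) (A : set T2) :
  \bar R := (\int[mu]_x k x A)%E.

Variables (mu : probability T1 R) (k : R.-pker T1 ~> T2).

Lemma kbind0 : kbind mu k set0 = 0%E.
Proof. by apply: integral0_eq => x _; rewrite measure0. Qed.

Lemma kbind_ge0 A : (0 <= kbind mu k A)%E.
Proof. by apply: integral_ge0 => x _; exact: measure_ge0. Qed.

Lemma kbind_sigma_additive : semi_sigma_additive (kbind mu k).
Proof.
move=> F mF tF mUF; rewrite /kbind.
rewrite (_ : (fun n => _) = (fun n =>
    \int[mu]_x (\sum_(0 <= i < n) k x (F i))%E)%E); last first.
  apply/funext => n; rewrite ge0_integral_sum// => i.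
  exact: measurable_kernel.
rewrite (_ : (\int[mu]_x _)%E =
    (\int[mu]_x limn (fun n => \sum_(0 <= i < n) k x (F i))%E)%E); last first.
  apply: eq_integral => x _; apply/esym/cvg_lim => //.
  exact: measure_semi_sigma_additive.
apply: cvg_monotone_convergence => //.
- move=> n; apply: emeasurable_sum => i; exact: measurable_kernel.
- by move=> n x _; apply: sume_ge0.
- by move=> x _ a b ab; apply: lee_sum_nneg_natr.
Qed.

HB.instance Definition _ := isMeasure.Build _ _ _ (kbind mu k)
  kbind0 kbind_ge0 kbind_sigma_additive.

Lemma kbind_setT : kbind mu k setT = 1%E.
Proof.
rewrite (_ : kbind mu k setT = \int[mu]__ 1)%E.
  by rewrite integral_cst// mul1e; exact: probability_setT.
by apply: eq_integral => x _; exact: prob_kernel.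
Qed.

HB.instance Definition _ := Measure_isProbability.Build _ _ _ (kbind mu k)
  kbind_setT.

End kbind.

(* law of (Gamma_s, X_s), 0 <= s <= n, started at (Gamma_0, X_0) = z0 *)
Fixpoint history_law (P : R.-pker (X * Y) ~> X) (Q : adaptation_plan)
    (z0 : Y * X) (n : nat) : probability (n.+1.-tuple (Y * X)) R :=
  match n with
  | 0 => \d_[tuple z0]
  | m.+1 => kbind (history_law P Q z0 m) (@one_step P Q m)
  end.

(* the law of X_n *)
Definition adaptive_law (P : R.-pker (X * Y) ~> X) (Q : adaptation_plan)
    (z0 : Y * X) (n : nat) : probability X R :=
  distribution (history_law P Q z0 n) (@last_state n).

End adaptive_process.
Arguments adaptation_plan {dX dY} X Y R.

Section tv_dist.
Context {d} {T : measurableType d} {R : realType}.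
Implicit Types mu nu : probability T R.

Definition coupling mu nu : set (probability (T * T)%type R) :=
  [set xi | forall A, measurable A ->
     xi (A `*` setT) = mu A /\ xi (setT `*` A) = nu A].

Definition tv_dist mu nu : \bar R :=
  ereal_inf [set xi [set p | p.1 <> p.2] | xi in coupling mu nu].

End tv_dist.

Section growth.
Variable R : realType.

Definition concave_on (D : set R) (f : R -> R) :=
  forall x y t : R, D x -> D y -> 0 <= t <= 1 ->
    t * f x + (1 - t) * f y <= f (t * x + (1 - t) * y).

Definition Hfun (w0 : R) (phi : R -> R) (w : R) : R :=
  \int[lebesgue_measure]_(v in `[w0, w]) (phi v)^-1.

(* The inverse of [Hfun w0 phi : [w0, +oo[ -> [0, +oo[]. The default value [w0]
   is only taken outside the range of [Hfun w0 phi], which is all of [0, +oo[ when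
   [phi] is positive and concave on ]0, +oo[. *)
Definition Hinv (w0 : R) (phi : R -> R) : R -> R :=
  'pinv_(fun=> w0) `[w0, +oo[ (Hfun w0 phi).

End growth.

(* Main.v *)
Require Import Defs.
From HB Require Import structures.
From mathcomp Require Import all_boot all_order all_algebra.
From mathcomp Require Import all_classical all_reals all_analysis.
From mathcomp Require Import measurable_realfun ring lra.

(** Put [V := W ^ alpha]. The drift condition says that one step of any kernel of
    the family increases [V] by at most [phi V] on average, whichever parameter
    was chosen, so no adaptation plan can make [V] grow faster than the recursion
    [v |-> v + phi v], and that recursion is dominated by the solution of
    [y' = phi y]. Thus [E V(X_t) <= G], where [G] is the value at time [t] of the
    solution started at [V x0], i.e. [Hinv (V x0) phi t] ([mean_le_Hinv]).
    The inequality passes from one time to the next by a linear majorant of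
    [phi] tangent at the current value ([concave_supporting_line]), which plays
    the part of Jensen's inequality ([mean_drift_step]), and on the other side
    because a positive concave [phi] is nondecreasing: while [H] grows by 1, the
    solution gains at least [phi] of its starting value ([Hinv_step]).

    By Markov's inequality the law of [X_t] gives [{W >= r}] mass at most
    [G / r ^ alpha], whereas [pi] gives it at least [C r ^ (- kappa)]. As
    [kappa < alpha], [pi] has the heavier tail, and the total variation distance
    is at least the difference of the two masses ([tv_dist_ge]). Maximising the
    difference over [r] yields the constant [M] ([optimal_tail_level]).

    The distance being an infimum over couplings, the comparison of masses needs
    the event that the two coordinates differ to be measurable for the product
    sigma-algebra; this is where the Polish assumption enters
    ([polish_diagonal_measurable]). *)

Import Order.TTheory GRing.Theory Num.Theory.
Import numFieldNormedType.Exports.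

Local Open Scope classical_set_scope.
Local Open Scope ring_scope.

(** * Positive concave functions on the half-line *)

Section concave_positive.
Context {R : realType} {phi : R -> R}.
Context (phi_gt0 : forall v : R, 0 < v -> 0 < phi v).
Context (phi_concave : concave_on `]0, +oo[ phi).

Lemma concave_combination u v s : 0 < u -> 0 < v -> 0 <= s <= 1 ->
  s * phi u + (1 - s) * phi v <= phi (s * u + (1 - s) * v).
Proof. by move=> u0 v0; apply: phi_concave; rewrite /= in_itv/= ?u0 ?v0. Qed.

(** The line through the points of the graph at [v] and [u] reaches height 0 at
    the abscissa [z] of the proof. Beyond [u] a concave function lies below that
    line, so [phi z <= 0] if [z] is in the domain: positivity forces [z <= 0]. *)
Lemma concave_positive_ratio u v : 0 < u -> 0 < v -> phi u < phi v ->
  u <= phi u / phi v * v.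
Proof.
move=> u0 v0 uv; set s := phi u / phi v; rewrite leNgt; apply/negP => su.
have pv := phi_gt0 v v0; have pu := phi_gt0 u u0.
have s0 : 0 < s by rewrite divr_gt0.
have s1 : 0 < 1 - s by rewrite subr_gt0 ltr_pdivrMr// mul1r.
pose z := (u - s * v) / (1 - s).
have z0 : 0 < z by rewrite divr_gt0// subr_gt0.
have s01 : 0 <= s <= 1 by rewrite (ltW s0) -subr_ge0 ltW.
have := concave_combination v z s v0 z0 s01.
have -> : s * v + (1 - s) * z = u.
  by rewrite /z mulrC [X in _ + X]mulrC divfK ?gt_eqF//; ring.
have -> : s * phi v = phi u by rewrite divfK// gt_eqF.
by rewrite gerDl leNgt mulr_gt0// phi_gt0.
Qed.

Lemma concave_positive_nondecreasing u v : 0 < u -> u <= v -> phi u <= phi v.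
Proof.
move=> u0 uv; have v0 : 0 < v by exact: lt_le_trans uv.
rewrite leNgt; apply/negP => vu.
have := concave_positive_ratio v u v0 u0 vu; apply/negP; rewrite -ltNge.
apply: lt_le_trans uv; rewrite gtr_pMl//.
by rewrite ltr_pdivrMr ?mul1r// phi_gt0.
Qed.

(** Growth at most linear makes the integral of [1 / phi] diverge at infinity. *)
Lemma concave_positive_sublinear u v : 0 < u -> u <= v ->
  u * phi v <= v * phi u.
Proof.
move=> u0 uv; have v0 : 0 < v by exact: lt_le_trans uv.
have pv := phi_gt0 v v0; have pu := phi_gt0 u u0.
have [vu|/(concave_positive_ratio u v u0 v0)] := leP (phi v) (phi u).
  by apply: ler_pM => //; exact: ltW.
by rewrite mulrAC ler_pdivlMr// [phi u * v]mulrC.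
Qed.

Lemma concave_slopes u m v : 0 < u -> u < m -> m < v ->
  (phi v - phi m) / (v - m) <= (phi m - phi u) / (m - u).
Proof.
move=> u0 um mv.
have vu : 0 < v - u by lra.
have t01 : 0 <= (v - m) / (v - u) <= 1.
  by rewrite divr_ge0 ?ler_pdivrMr//=; lra.
have := concave_combination u v ((v - m) / (v - u)) u0.
move=> /(_ ltac:(lra) t01).
have -> : (v - m) / (v - u) * u + (1 - (v - m) / (v - u)) * v = m.
  by field; rewrite gt_eqF.
rewrite -(ler_pM2r vu) mulrDl mulrAC divfK ?gt_eqF//.
have -> : (1 - (v - m) / (v - u)) * phi v * (v - u) = (m - u) * phi v.
  by field; rewrite gt_eqF.
move=> H; rewrite ler_pdivrMr ?subr_gt0// mulrAC ler_pdivlMr ?subr_gt0//.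
nra.
Qed.

(** The slope is the right derivative at [m], the supremum of the slopes of
    chords to the right, which any chord to the left bounds from above. *)
Lemma concave_supporting_line m : 0 < m ->
  exists2 s, 0 <= s & forall v, 0 < v -> phi v <= phi m + s * (v - m).
Proof.
move=> m0.
pose S := [set (phi v - phi m) / (v - m) | v in `]m, +oo[].
have Sub u : 0 < u -> u < m -> ubound S ((phi m - phi u) / (m - u)).
  move=> u0 um _ [v mv <-]; move: mv; rewrite /= in_itv/= andbT => mv.
  exact: concave_slopes.
have hS : has_ubound S.
  by exists ((phi m - phi (m / 2)) / (m - m / 2)); apply: Sub; lra.
have leS v : m < v -> (phi v - phi m) / (v - m) <= sup S.
  by move=> mv; apply: ub_le_sup => //; exists v => //=; rewrite in_itv/= mv.
exists (sup S).
  apply: le_trans (leS (m + 1) ltac:(lra)).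
  rewrite divr_ge0 ?subr_ge0//; last lra.
  by apply: concave_positive_nondecreasing; lra.
move=> v v0; have [mv|vm|->] := ltgtP m v; last by rewrite subrr mulr0 addr0.
  by rewrite -lerBlDl -ler_pdivrMr ?subr_gt0// leS.
have : sup S <= (phi m - phi v) / (m - v).
  apply: ge_sup; last exact: Sub.
  exists ((phi (m + 1) - phi m) / (m + 1 - m)), (m + 1) => //=.
  by rewrite in_itv/= andbT; lra.
rewrite ler_pdivlMr ?subr_gt0//; lra.
Qed.

End concave_positive.

(** * The time change [Hfun] and its inverse *)

Section growth_time.
Context {R : realType} {phi : R -> R}.
Context (phi_gt0 : forall v : R, 0 < v -> 0 < phi v).
Context (phi_concave : concave_on `]0, +oo[ phi).
Context (w0 : R) (w0_gt0 : 0 < w0).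

Local Notation mu := (@lebesgue_measure R).

Let phi_le (u v : R) : 0 < u -> u <= v -> phi u <= phi v.
Proof. exact: concave_positive_nondecreasing. Qed.

Let integrable_invphi b : mu.-integrable `[w0, b] (fun v => ((phi v)^-1)%:E).
Proof.
apply: measurable_bounded_integrable => //.
- by rewrite /= lebesgue_measure_itv/=; case: ifPn => // _; rewrite -EFinB ltry.
- (* off the interval [phi] may behave badly: freeze it below [w0] to get a
     function that is monotone, hence measurable, on the whole line *)
  apply: (eq_measurable_fun (fun v => (phi (Num.max w0 v))^-1)).
    by move=> v; rewrite inE/= in_itv/= => /andP[wv _]; rewrite max_r.
  apply: nonincreasing_measurable => // u v uv.
  have mx z : 0 < Num.max w0 z by rewrite lt_max w0_gt0.
  rewrite lef_pV2 ?posrE ?phi_gt0//; apply: phi_le => //.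
  by rewrite ge_max !le_max lexx uv orbT.
- exists (phi w0)^-1; split; first exact: num_real.
  move=> M hM v /=; rewrite in_itv/= => /andP[wv _].
  have v0 := lt_le_trans w0_gt0 wv.
  rewrite ger0_norm ?invr_ge0 ?ltW ?phi_gt0//; apply: le_lt_trans hM.
  by rewrite lef_pV2 ?posrE ?phi_gt0// phi_le.
Qed.

(** Since [1 / phi] is nonincreasing, its extreme values on an interval are those
    at the endpoints. *)
Lemma Hfun_increment a b : w0 <= a -> a <= b ->
  (b - a) / phi b <= Hfun w0 phi b - Hfun w0 phi a <= (b - a) / phi a.
Proof.
move=> wa ab; have a0 : 0 < a by exact: lt_le_trans wa.
have iab : mu.-integrable `]a, b] (fun v => ((phi v)^-1)%:E).
  apply: integrableS (integrable_invphi b) => //.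
  by apply: subset_itvr; rewrite bnd_simp.
rewrite /Hfun Rintegral_itvB ?bnd_simp//.
have cstE (c : R) : \int[mu]_(v in `]a, b]) c = (b - a) * c.
  rewrite Rintegral_cst//= lebesgue_measure_itv/= lte_fin mulrC.
  case: ltP => //=.
  move=> ba; have -> : a = b by apply/eqP; rewrite eq_le ab ba.
  by rewrite subrr !mul0r.
have icst (c : R) : mu.-integrable `]a, b] (fun=> c%:E).
  apply: measurable_bounded_integrable => //; last exact: bounded_cst.
  by rewrite /= lebesgue_measure_itv/=; case: ifPn => // _; rewrite -EFinB ltry.
have inv_le v : a <= v -> v <= b -> (phi b)^-1 <= (phi v)^-1 <= (phi a)^-1.
  move=> av vb; have v0 := lt_le_trans a0 av; have b0 := lt_le_trans v0 vb.
  by rewrite !lef_pV2 ?posrE ?phi_gt0// !phi_le.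
rewrite -!cstE; apply/andP; split; apply: le_Rintegral => //;
  try exact: icst; move=> v /=; rewrite in_itv/= => /andP[/ltW av vb];
  by have /andP[] := inv_le _ av vb.
Qed.

Lemma Hfun_start : Hfun w0 phi w0 = 0.
Proof. by rewrite /Hfun set_itv1 Rintegral_set1. Qed.

Lemma le_Hfun a b : w0 <= a -> a <= b -> Hfun w0 phi a <= Hfun w0 phi b.
Proof.
move=> wa ab; have a0 : 0 < a by exact: lt_le_trans wa.
rewrite -subr_ge0; have /andP[+ _] := Hfun_increment a b wa ab.
apply: le_trans.
by rewrite divr_ge0 ?subr_ge0// ltW// phi_gt0// (lt_le_trans a0).
Qed.

(** [Hfun] is Lipschitz with constant [1 / phi w0]; it vanishes below [w0], so
    this holds on the whole line. *)
Lemma Hfun_continuous b : {within `[w0, b], continuous (Hfun w0 phi)}.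
Proof.
pose G x := Hfun w0 phi (Num.max w0 x).
have -> : Hfun w0 phi = G.
  apply/funext => x; rewrite /G; have [//|xw] := leP w0 x.
  by rewrite Hfun_start /Hfun set_itv_ge ?bnd_simp -?ltNge// Rintegral_set0.
apply: continuous_subspaceT => x.
have p0 := phi_gt0 w0 w0_gt0.
have incr a c : a <= c -> `|G a - G c| <= (c - a) / phi w0.
  move=> ac; have wa : w0 <= Num.max w0 a by rewrite le_max lexx.
  have mac : Num.max w0 a <= Num.max w0 c by rewrite ge_max !le_max lexx ac orbT.
  have /andP[_ h] := Hfun_increment _ _ wa mac.
  rewrite distrC ger0_norm ?subr_ge0 ?le_Hfun//; apply: (le_trans h).
  rewrite ler_pM ?subr_ge0 ?invr_ge0//.
  - by rewrite ltW// phi_gt0// lt_max w0_gt0.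
  - rewrite lerBlDr ge_max; apply/andP; split.
      by rewrite -[leLHS]add0r lerD ?subr_ge0.
    by rewrite -[leLHS](subrK a) lerD2l le_max lexx orbT.
  - by rewrite lef_pV2 ?posrE ?phi_gt0 ?phi_le// lt_max w0_gt0.
apply/cvgrPdist_lt => e e0; near=> y.
have : `|x - y| < e * phi w0.
  by near: y; apply: cvgr_dist_lt => //; rewrite mulr_gt0.
have [xy|/ltW yx] := leP x y => xye.
  apply: le_lt_trans (incr _ _ xy) _.
  by rewrite ltr_pdivrMr// (le_lt_trans (ler_norm _))// distrC.
rewrite distrC; apply: le_lt_trans (incr _ _ yx) _.
by rewrite ltr_pdivrMr// (le_lt_trans (ler_norm _)).
Unshelve. all: by end_near. Qed.

(** By the sublinearity of [phi], each doubling of the upper bound adds the same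
    amount to the integral: a version of logarithmic growth that is enough to see
    that [Hfun] is unbounded. *)
Lemma Hfun_doubling n : n%:R * (w0 / phi w0 / 2) <= Hfun w0 phi (2 ^+ n * w0).
Proof.
elim: n => [|n ih]; first by rewrite mul0r expr0 mul1r Hfun_start.
set a := 2 ^+ n * w0 in ih *.
have a0 : 0 < a by rewrite mulr_gt0// exprn_gt0.
have wa : w0 <= a.
  by apply: ler_peMl; [exact: ltW|apply: exprn_ege1; rewrite ler1n].
have -> : 2 ^+ n.+1 * w0 = 2 * a by rewrite exprS mulrA.
have aa : a <= 2 * a by lra.
have /andP[h _] := Hfun_increment _ _ wa aa.
have p0 := phi_gt0 w0 w0_gt0.
have p2 : 0 < phi (2 * a) by rewrite phi_gt0// mulr_gt0.
have : w0 / phi w0 / 2 <= (2 * a - a) / phi (2 * a).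
  have -> : 2 * a - a = a by ring.
  rewrite ler_pdivlMr// mulrAC ler_pdivrMr// mulrAC ler_pdivrMr//.
  rewrite [a * 2]mulrC; apply: concave_positive_sublinear => //.
  exact: le_trans aa.
by move=> ?; rewrite -natr1 mulrDl mul1r; lra.
Qed.

Lemma Hfun_surj t : 0 <= t -> exists2 w, w0 <= w & Hfun w0 phi w = t.
Proof.
move=> t0.
have c0 : 0 < w0 / phi w0 / 2 by rewrite !divr_gt0 ?phi_gt0.
have [n tn] : exists n : nat, t <= Hfun w0 phi (2 ^+ n * w0).
  exists (Num.trunc (t / (w0 / phi w0 / 2))).+1.
  apply: le_trans (Hfun_doubling _).
  by rewrite -ler_pdivrMr// ltW// truncnS_gt.
have wb : w0 <= 2 ^+ n * w0.
  by apply: ler_peMl; [exact: ltW|apply: exprn_ege1; rewrite ler1n].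
have := @IVT R (Hfun w0 phi) _ _ t wb (Hfun_continuous _).
have H0 := le_trans t0 tn.
rewrite Hfun_start min_l// max_r// t0 tn => /(_ isT)[w].
rewrite in_itv/= => /andP[ww _] Hw.
by exists w.
Qed.

(** Surjectivity rules out the default value of the partial inverse. *)
Lemma HinvP t : 0 <= t ->
  w0 <= Hinv w0 phi t /\ Hfun w0 phi (Hinv w0 phi t) = t.
Proof.
move=> t0.
have surj : set_surj `[w0, +oo[ [set s | 0 <= s] (Hfun w0 phi).
  move=> s /= /Hfun_surj[w ww <-].
  by exists w => //=; rewrite in_itv/= ww.
split.
  have : [set` `[w0, +oo[] (Hinv w0 phi t).
    by apply: (surjpinv_image_sub surj); exists t.
  by rewrite /= in_itv/= andbT.
by apply: (surjpK _ surj); rewrite inE.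
Qed.

(** Between the times [n] and [n.+1] the integral of [1 / phi] grows by 1, while
    [1 / phi] is at most its value at the start of the interval; so the interval
    is at least as long as the value of [phi] there. *)
Lemma Hinv_step n :
  Hinv w0 phi n%:R + phi (Hinv w0 phi n%:R) <= Hinv w0 phi n.+1%:R.
Proof.
have [wy Hy] := HinvP n%:R (ler0n _ _).
have [wz Hz] := HinvP n.+1%:R (ler0n _ _).
move: (Hinv w0 phi n%:R) (Hinv w0 phi n.+1%:R) wy Hy wz Hz => y z wy Hy wz Hz.
have y0 : 0 < y by exact: lt_le_trans wy.
have yz : y <= z.
  rewrite leNgt; apply/negP => /ltW zy.
  by have := le_Hfun _ _ wz zy; rewrite Hy Hz ler_nat ltnn.
have /andP[_] := Hfun_increment _ _ wy yz.
rewrite Hy Hz -natr1 [_ + 1]addrC addrK ler_pdivlMr ?phi_gt0// mul1r.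
by rewrite lerBrDl.
Qed.

End growth_time.

(** * Means along the adaptive process *)

Section integral_kbind.
Context {d1 d2} {T1 : measurableType d1} {T2 : measurableType d2} {R : realType}.

(** [kbind mu k] is the composition of kernels in which the first one is
    constant, on a one-point space. *)
Lemma integral_kbind (mu : probability T1 R) (k : R.-pker T1 ~> T2)
    (f : T2 -> \bar R) :
  (forall z, 0 <= f z)%E -> measurable_fun [set: T2] f ->
  (\int[kbind mu k]_z f z = \int[mu]_x \int[k x]_z f z)%E.
Proof.
move=> f0 mf.
pose l : R.-sfker unit ~> T1 :=
  kprobability
    (measurable_cst (mu : pprobability T1 R) : measurable_fun [set: unit] _).
pose k' : R.-sfker (unit * T1) ~> T2 := kernel.kernel_snd k.
exact: (integral_kcomp l k' tt f0 mf).
Qed.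

End integral_kbind.

Section process_mean.
Context {dX dY} {X : measurableType dX} {Y : measurableType dY} {R : realType}.
Context (P : R.-pker (X * Y) ~> X) (Q : adaptation_plan X Y R).

Lemma last_state_append n (hg : n.+1.-tuple (Y * X) * Y) (x : X) :
  last_state (append hg x) = x.
Proof.
rewrite /last_state /append (tnth_nth (hg.2, x)) /= nth_rcons.
by rewrite size_tuple ltnn eqxx.
Qed.

Lemma integral_one_step n (h : n.+1.-tuple (Y * X)) (f : X -> \bar R) :
  (forall x, 0 <= f x)%E -> measurable_fun [set: X] f ->
  (\int[one_step P Q h]_h' f (last_state h') =
   \int[Q n h]_g \int[P (last_state h, g)]_x f x)%E.
Proof.
move=> f0 mf.
have mfl m : measurable_fun [set: m.+1.-tuple (Y * X)]
    (fun h => f (last_state h)).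
  by apply: measurableT_comp => //; exact: measurable_last_state.
rewrite integral_kcomp//; last exact: mfl.
apply: eq_integral => g _; rewrite ge0_integral_pushforward//.
  by apply: eq_integral => x _ /=; rewrite last_state_append.
exact: mfl.
Qed.

(** Bounding [phi] by its tangent [c + s v] at [m] makes the mean increment
    affine in [V], so that a bound on the mean of [V] suffices. Since [s >= 0],
    [m] may be any upper bound of the mean, and the mean need not be known to be
    finite beforehand. *)
Lemma mean_drift_step (V : X -> R) (phi : R -> R) z0 n (m : R) :
  measurable_fun [set: X] V -> (forall x, 0 < V x) ->
  (forall v, 0 < v -> 0 < phi v) -> concave_on `]0, +oo[ phi ->
  (forall x g, \int[P (x, g)]_y (V y)%:E <= (V x + phi (V x))%:E)%E ->
  0 < m ->
  (\int[history_law P Q z0 n]_h (V (last_state h))%:E <= m%:E)%E ->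
  (\int[history_law P Q z0 n.+1]_h (V (last_state h))%:E <= (m + phi m)%:E)%E.
Proof.
move=> mV V0 phi0 phi_c drift m0 Vm.
have [s s0 phi_s] := concave_supporting_line phi0 phi_c m m0.
have mEV : measurable_fun [set: X] (EFin \o V) by exact/measurable_EFinP.
have EV0 x : (0 <= (EFin \o V) x)%E by rewrite lee_fin ltW.
have mVL k : measurable_fun [set: k.+1.-tuple (Y * X)]
    (fun h => (V (last_state h))%:E).
  by apply: (measurableT_comp mEV); exact: measurable_last_state.
rewrite integral_kbind; [|by move=> h; exact: EV0|exact: mVL].
pose c := phi m - s * m.
have phi_le v : 0 < v -> phi v <= c + s * v.
  by move=> /phi_s; rewrite /c; lra.
(* the tangent lies above the positive function [phi] all the way down to 0;
   the point [e / s] below is where it exceeds [c] by [e] *)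
have c0 : 0 <= c.
  apply/ler_addgt0Pr => e e0.
  have [s_0|s1] := eqVneq s 0.
    by rewrite /c s_0 mul0r subr0 addr_ge0 ?ltW// phi0.
  have sp : 0 < s by rewrite lt_neqAle eq_sym s1.
  have := phi_le (e / s) (divr_gt0 e0 sp).
  rewrite [s * _]mulrC divfK ?gt_eqF//; apply: le_trans.
  by rewrite ltW// phi0// divr_gt0.
have mK : measurable_fun [set: n.+1.-tuple (Y * X)]
    (fun h => (1 + s)%:E * (V (last_state h))%:E)%E.
  by apply: measurable_funeM; exact: mVL.
have K0 (h : n.+1.-tuple (Y * X)) : (0 <= (1 + s)%:E * (V (last_state h))%:E)%E.
  by rewrite mule_ge0// ?EV0// lee_fin addr_ge0.
apply: (@le_trans _ _ (\int[history_law P Q z0 n]_h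
   (c%:E + (1 + s)%:E * (V (last_state h))%:E))%E).
  apply: ge0_le_integral => //.
  - by move=> h _; apply: integral_ge0 => h' _; exact: EV0.
  - apply: measurable_fun_integral_kernel => //.
    + by move=> U mU; exact: measurable_kernel.
    + by move=> h; exact: EV0.
    + exact: mVL.
  - exact: emeasurable_funD.
  move=> h _; rewrite (integral_one_step n h (EFin \o V))//.
  rewrite -[leRHS]mule1 -(prob_kernel (s := Q n) h) -integral_cst//.
  apply: ge0_le_integral => //.
  - by move=> g _; apply: integral_ge0 => x _; exact: EV0.
  - apply: measurable_fun_integral_kernel => //.
    move=> U mU; apply: (measurableT_comp (measurable_kernel P U mU)).
    exact: measurable_fun_pair.
  move=> g _; apply: le_trans (drift _ _) _.
  rewrite -EFinM -EFinD lee_fin.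
  have := phi_le _ (V0 (last_state h)); lra.
rewrite ge0_integralD//.
rewrite integral_cst// [X in (c%:E * X)%E](_ : _ = 1%E); last first.
  exact: probability_setT.
rewrite mule1 ge0_integralZl//; last 3 first.
- exact: mVL.
- by move=> h _; exact: EV0.
- by rewrite lee_fin addr_ge0.
apply: (@le_trans _ _ (c%:E + (1 + s)%:E * m%:E)%E).
  by rewrite leeD2l// lee_wpmul2l// lee_fin; lra.
by rewrite -EFinM -EFinD lee_fin /c; lra.
Qed.

Lemma mean_le_Hinv (V : X -> R) (phi : R -> R) (z0 : Y * X) n :
  measurable_fun [set: X] V -> (forall x, 0 < V x) ->
  (forall v : R, 0 < v -> 0 < phi v) -> concave_on `]0, +oo[ phi ->
  (forall x g, \int[P (x, g)]_y (V y)%:E <= (V x + phi (V x))%:E)%E ->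
  (\int[history_law P Q z0 n]_h (V (last_state h))%:E <=
     (Hinv (V z0.2) phi n%:R)%:E)%E.
Proof.
move=> mV V0 phi0 phi_c drift.
have mEV : measurable_fun [set: X] (EFin \o V) by exact/measurable_EFinP.
have H0 k : 0 < Hinv (V z0.2) phi k%:R.
  by apply: lt_le_trans (HinvP phi0 phi_c _ (V0 z0.2) _ (ler0n _ k)).1.
elim: n => [|n ih].
  rewrite integral_dirac//; last first.
    by apply: (measurableT_comp mEV); exact: measurable_last_state.
  rewrite diracT mul1e lee_fin.
  exact: (HinvP phi0 phi_c _ (V0 z0.2) _ (ler0n _ 0)).1.
apply: le_trans (mean_drift_step V phi z0 n _ mV V0 phi0 phi_c drift (H0 n) ih) _.
by rewrite lee_fin; exact: Hinv_step.
Qed.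

Lemma adaptive_law_markov (V : X -> R) z0 n (a : R) :
  measurable_fun [set: X] V -> (forall x, 0 < V x) -> 0 < a ->
  (a%:E * adaptive_law P Q z0 n [set x | (a <= V x)%R] <=
   \int[history_law P Q z0 n]_h (V (last_state h))%:E)%E.
Proof.
move=> mV V0 a0.
have mEV : measurable_fun [set: X] (EFin \o V) by exact/measurable_EFinP.
have mVL : measurable_fun [set: n.+1.-tuple (Y * X)]
    (fun h => (V (last_state h))%:E).
  by apply: (measurableT_comp mEV); exact: measurable_last_state.
have := @le_integral_abse _ _ _ (history_law P Q z0 n) _ measurableT _ a mVL a0.
under eq_integral do rewrite gee0_abs ?lee_fin ?ltW//.
apply: le_trans; apply: lee_wpmul2l; first by rewrite lee_fin ltW.
rewrite setTI; suff -> : [set h | (a%:E <= `|(V (last_state h))%:E|)%E] =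
    @last_state _ _ X Y n @^-1` [set x | a <= V x] by [].
by apply/seteqP; split => h /=; rewrite lee_fin ger0_norm// ltW.
Qed.

End process_mean.

(** * Lower bounds on the total variation distance *)

(** Two distinct points at distance [e] are separated by any ball of radius below
    [e / 2] that contains the first one; countably many balls suffice. So the
    complement of the diagonal is a countable union of measurable rectangles. *)
Lemma polish_diagonal_measurable (R : realType) (X : ptopologicalType) :
  polish_space R X ->
  measurable [set p : borel X * borel X | p.1 <> p.2].
Proof.
move=> [[D [cD dD]] [d [[d_ge0 d_eq0 d_sym d_tri] d_top _]]].
pose B (q : X) (r : R) := [set y | d q y < r].
have oB q r : open (B q r).
  rewrite openE => y; rewrite /B /= => qy.
  rewrite /interior; apply/d_top; exists (r - d q y); first by rewrite subr_gt0.
  move=> z /=; rewrite ltrBrDl => yz; exact: le_lt_trans (d_tri _ y _) yz.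
have mB q r : measurable (B q r : set (borel X)).
  exact: sub_sigma_algebra (oB q r).
pose r_ n : R := n.+1%:R^-1.
have -> : [set p : borel X * borel X | p.1 <> p.2] =
    \bigcup_(q in D) \bigcup_n (B q (r_ n) `*` ~` B q (r_ n)).
  apply/seteqP; split=> [[x y] /= xy|[x y] [q Dq [n _ [/= xB yB]]] xy]; last first.
    by rewrite xy in xB.
  have dxy : 0 < d x y.
    by rewrite lt_neqAle d_ge0 andbT; apply/eqP => /esym/d_eq0.
  have [n nxy] : exists n, r_ n < d x y / 2.
    exists (Num.trunc ((d x y / 2)^-1)).
    by rewrite /r_ invf_plt ?posrE ?divr_gt0// truncnS_gt.
  have [|q [qx Dq]] := dD _ _ (oB x (r_ n)).
    by exists x; rewrite /B/= (d_eq0 x x).2// invr_gt0.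
  exists q => //; exists n => //; split => /=; first by rewrite /B /= d_sym.
  move=> qy; have := d_tri x q y; move: qx qy; rewrite /B/= => qx qy; lra.
rewrite bigcup_set_type; apply: countable_bigcupT_measurable => [|q].
  by rewrite (eq_countable (card_setT _)).
apply: bigcupT_measurable => n.
by apply: measurableX => //; exact: measurableC.
Qed.

(** For any coupling, [nu A] is the mass of the pairs whose second entry is in
    [A]: either the entries differ, or the first one is in [A] as well. *)
Lemma tv_dist_ge (d : measure_display) (T : measurableType d) (R : realType)
    (mu nu : probability T R) (A : set T) :
  measurable [set p : T * T | p.1 <> p.2] -> measurable A ->
  (nu A - mu A <= tv_dist mu nu)%E.
Proof.
move=> mD mA; apply: le_ereal_inf_tmp => _ [xi cxi <-].
have [muA _] := cxi A mA; have [_ nuA] := cxi A mA.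
rewrite -muA -nuA.
have mA1 : measurable (A `*` [set: T]) by exact: measurableX.
have mA2 : measurable ([set: T] `*` A) by exact: measurableX.
rewrite leeBlDr ?fin_num_measure//; apply: le_trans (measureU2 _ mD mA1).
apply: le_measure; rewrite ?inE//; first exact: measurableU.
move=> [x y] /= [_ Ay]; have [->|] := pselect (x = y); last by left.
by right.
Qed.
(** * The threshold and the theorem *)

Lemma powRVl {R : realType} (x p : R) : 0 <= x -> x^-1 `^ p = (x `^ p)^-1.
Proof. by move=> x0; rewrite -powR_inv1// -powRrM mulN1r powRN. Qed.

(** The difference is largest where its derivative in [r] vanishes, i.e. where
    [r ^ (alpha - kappa) = alpha G / (kappa C)]. This [r] is at least 1 because
    [kappa < alpha] and [C <= 1 <= G]. *)
Lemma optimal_tail_level {R : realType} (C kappa alpha G : R) :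
  0 < C -> C <= 1 -> 0 < kappa -> kappa < alpha -> 1 <= G ->
  let M := C `^ (alpha / (alpha - kappa)) *
           ((kappa / alpha) `^ (kappa / (alpha - kappa)) -
            (kappa / alpha) `^ (alpha / (alpha - kappa))) in
  exists2 r, 1 <= r &
    C * r `^ (- kappa) - G / r `^ alpha = M / G `^ (kappa / (alpha - kappa)).
Proof.
move=> C0 C1 k0 ka G1 M.
have a0 : 0 < alpha by exact: lt_trans ka.
have G0 : 0 < G by exact: lt_le_trans G1.
have d0 : 0 < alpha - kappa by rewrite subr_gt0.
pose x := alpha * G / (kappa * C).
have x1 : 1 <= x.
  rewrite ler_pdivlMr ?mulr_gt0// mul1r.
  by apply: ler_pM; [exact: ltW|exact: ltW|exact: ltW|exact: le_trans G1].
have xV : x^-1 = kappa / alpha * C * G^-1.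
  by rewrite /x; field; rewrite !gt_eqF.
exists (x `^ (alpha - kappa)^-1).
  by rewrite -[leLHS](powRr0 x) ler_powR// invr_ge0 ltW.
rewrite -!powRrM mulrN powRN ![_^-1 * _]mulrC.
have x0 : 0 <= x by rewrite (le_trans ler01).
rewrite -!(powRVl x)// xV.
have ka_ge0 : 0 <= kappa / alpha by rewrite divr_ge0 ?ltW.
rewrite {}/M; move: (kappa / alpha) ka_ge0 => u u0 {x x1 xV x0}.
have -> : alpha / (alpha - kappa) = kappa / (alpha - kappa) + 1.
  by field; rewrite gt_eqF.
move: (kappa / (alpha - kappa)) => p.
have C_ge0 := ltW C0; have G_ge0 := ltW G0.
have C_neq0 : C != 0 by rewrite gt_eqF.
have G_neq0 : G != 0 by rewrite gt_eqF.
rewrite !powRM ?mulr_ge0 ?invr_ge0// !powRVl//.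
rewrite ![C `^ (p + 1)]powRD ?C_neq0 ?implybT//.
rewrite ![G `^ (p + 1)]powRD ?G_neq0 ?implybT//.
rewrite !powRr1//.
by field; rewrite G_neq0 gt_eqF// powR_gt0.
Qed.

Theorem theorem1 (R : realType) (X Y : ptopologicalType)
    (polishX : polish_space R X)
    (pi : probability (borel X) R)
    (P : R.-pker (borel X * borel Y) ~> borel X)
    (W : borel X -> R)
    (measurableW : measurable_fun [set: borel X] W)
    (W_ge1 : forall x : borel X, 1 <= W x)
    (C kappa : R) (C_gt0 : 0 < C) (C_le1 : C <= 1) (kappa_gt0 : 0 < kappa)
    (tail : forall r : R, 1 <= r ->
      ((C * r `^ (- kappa))%:E <= pi [set x | (r <= W x)%R])%E)
    (alpha : R) (alpha_gt : kappa < alpha)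
    (phi : R -> R)
    (phi_gt0 : forall v : R, 0 < v -> 0 < phi v)
    (phi_concave : concave_on `]0, +oo[ phi)
    (drift : forall (x : borel X) (g : borel Y),
      ((\int[P (x, g)]_y (W y `^ alpha)%:E) - (W x `^ alpha)%:E
         <= (phi (W x `^ alpha))%:E)%E)
    (t : nat) (t_gt0 : (0 < t)%N) (g0 : borel Y) (x0 : borel X) :
  let M := C `^ (alpha / (alpha - kappa)) *
           ((kappa / alpha) `^ (kappa / (alpha - kappa)) -
            (kappa / alpha) `^ (alpha / (alpha - kappa))) in
  ((M / Hinv (W x0 `^ alpha) phi t%:R `^ (kappa / (alpha - kappa)))%:E <=
   ereal_inf [set tv_dist (adaptive_law P Q (g0, x0) t) pi |
              Q in [set: adaptation_plan (borel X) (borel Y) R]])%E.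
Proof.
cbv zeta; apply: le_ereal_inf_tmp => _ [Q _ <-].
have a0 : 0 < alpha by exact: lt_trans alpha_gt.
pose V x := W x `^ alpha.
have V0 x : 0 < V x by rewrite powR_gt0// (lt_le_trans ltr01).
have mV : measurable_fun [set: borel X] V.
  by apply: (measurableT_comp (measurable_powR alpha)).
have driftV x g : (\int[P (x, g)]_y (V y)%:E <= (V x + phi (V x))%:E)%E.
  by rewrite addrC EFinD -leeBlDr//; exact: drift.
have mean := mean_le_Hinv P Q V phi (g0, x0) t mV V0 phi_gt0 phi_concave driftV.
have G1 : 1 <= Hinv (W x0 `^ alpha) phi t%:R.
  apply: le_trans (HinvP phi_gt0 phi_concave _ (V0 x0) _ (ler0n _ t)).1.
  have -> : 1 = 1 `^ alpha :> R by rewrite powR1.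
  by rewrite ge0_ler_powR ?nnegrE ?(ltW a0)// (le_trans ler01).
have [r r1 rE] :=
  optimal_tail_level C kappa alpha _ C_gt0 C_le1 kappa_gt0 alpha_gt G1.
rewrite -[X in (X%:E <= _)%E]rE.
have r0 : 0 < r by exact: lt_le_trans r1.
have ra0 : 0 < r `^ alpha by rewrite powR_gt0.
pose A := [set x : borel X | (r `^ alpha <= V x)%R].
have mA : measurable A.
  by rewrite -[A]setTI; apply: measurable_fun_le => //.
have mD := polish_diagonal_measurable _ _ polishX.
apply: le_trans (tv_dist_ge _ _ _ _ _ A mD mA).
rewrite EFinB; apply: leeB.
  apply: le_trans (tail r r1) _; apply: le_measure; rewrite ?inE//.
    rewrite -[X in measurable X]setTI; exact: measurable_fun_le.
  move=> x /= rW; rewrite /A /= /V ge0_ler_powR ?nnegrE ?(ltW a0) ?(ltW r0)//.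
  by rewrite (le_trans ler01).
have := adaptive_law_markov P Q V (g0, x0) t _ mV V0 ra0.
move=> /le_trans /(_ mean); rewrite -lee_pdivlMl//.
by move=> /le_trans; apply; rewrite -EFinM mulrC lexx.
Qed.
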